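(* There is an absolute constant $C>0$ such that for every pair of integers $k\ge 1$ and $n\ge k+2$, $$(n-1)(1+k/2) \;\le\; M_{n,k} \;\le\; n(1+k/2) + C k^2 .$$ Furthermore, if $n\equiv 1 \pmod{k+1}$, then $M_{n,k}=(n-1)(1+k/2)$.
   Context: All graphs are finite, simple and undirected. A $k$-truss is a graph with no isolated vertices in which every edge is contained in at least $k$ triangles. $M_{n,k}$ denotes the minimum number of edges of a connected $k$-truss on exactly $n$ vertices. *)

(* Defs.v *)
From HB Require Import structures.
From mathcomp Require Import all_boot all_order all_algebra.
From mathcomp Require Import reals.

Set Implicit Arguments.
Unset Strict Implicit.
Unset Printing Implicit Defensive.

Record sgraph := SGraph {
  vertex :> finType;
  adj : rel vertex;
  adj_sym : symmetric adj;
  adj_irrefl : irreflexive adj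
}.

Definition edges (G : sgraph) : {set {set G}} :=
  [set f : {set G} | [exists x, exists y, adj x y && (f == [set x; y])]].

Definition triangles (G : sgraph) : {set {set G}} :=
  [set t : {set G} | (#|t| == 3) &&
     [forall x in t, forall y in t, (x != y) ==> adj x y]].

Definition no_isolated_vertex (G : sgraph) : Prop :=
  forall x : G, exists y : G, adj x y.

Definition truss (k : nat) (G : sgraph) : Prop :=
  no_isolated_vertex G /\
  forall f : {set G}, f \in edges G ->
    k <= #|[set t in triangles G | f \subset t]|.

Definition connected_graph (G : sgraph) : Prop :=
  forall x y : G, connect (@adj G) x y.

Definition connected_truss (n k : nat) (G : sgraph) : Prop :=
  [/\ #|G| = n, connected_graph G & truss k G].

(* [is_min_edges n k m] reads "M_{n,k} exists and equals m": a relation, since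
   for n < k + 2 there may be no connected k-truss on n vertices. *)
Definition is_min_edges (n k m : nat) : Prop :=
  (exists2 G : sgraph, connected_truss n k G & #|edges G| = m) /\
  (forall G : sgraph, connected_truss n k G -> m <= #|edges G|).

(* Main.v *)
(** Lower bound: let [d] be the distance to a root [r]. Counting every ordered
    adjacent pair [(v, w)] with weight 2 if [d w < d v], 1 if [d w = d v] and 0
    otherwise gives twice the number of edges. A vertex [v != r] has a parent
    [p], one step closer to [r], and all the (at least [k]) common neighbours of
    [v] and [p] are at distance at most [d p + 1 = d v]; so [v] contributes at
    least [k + 2], whence [2 |E| >= (n - 1) (k + 2)].

    Upper bound: write [n - 1 = q (k + 1) + s] with [s <= k] and glue [q] cliques
    at one common vertex, all of them on [k + 2] vertices except one, on
    [k + 2 + s] vertices. Then [2 |E| = (n - 1) (k + 2) + s (k + 1 + s)], which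
    meets the lower bound exactly when [s = 0]. *)
Require Import Defs.
From HB Require Import structures.
From mathcomp Require Import all_boot all_order all_algebra.
From mathcomp Require Import reals boolp.
From mathcomp Require Import zify lra.

Set Implicit Arguments.
Unset Strict Implicit.
Unset Printing Implicit Defensive.

Import Order.TTheory GRing.Theory Num.Theory.

(** * Double counting of edges and triangles *)

Lemma edgesP (G : sgraph) (f : {set G}) :
  reflect (exists x y : G, adj x y /\ f = [set x; y]) (f \in edges G).
Proof.
rewrite inE; apply: (iffP existsP) => [[x /existsP[y /andP[xy /eqP->]]]|].
  by exists x, y.
by move=> [x [y [xy ->]]]; exists x; apply/existsP; exists y; rewrite xy eqxx.
Qed.

Lemma adj_neq (G : sgraph) (x y : G) : adj x y -> x != y.
Proof. by apply: contraTneq => ->; rewrite adj_irrefl. Qed.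

Lemma handshake (G : sgraph) :
  \sum_(x : G) \sum_(y : G) adj x y = (#|edges G|).*2.
Proof.
rewrite pair_big /= -big_mkcond /=.
(* Group the ordered adjacent pairs by their underlying edge; each fibre is [{(x, y), (y, x)}]. *)
rewrite (partition_big (fun p : G * G => [set p.1; p.2]) (mem (edges G))) /=; last first.
  by move=> [x y] /= xy; apply/edgesP; exists x, y.
rewrite -muln2 -sum_nat_const; apply: eq_bigr => f /edgesP[x [y [xy ->]]].
have neq_xy := adj_neq xy.
rewrite sum1_card -(_ : #|[set (x, y); (y, x)]| = 2); last first.
  by rewrite cards2 xpair_eqE negb_and neq_xy.
apply: eq_card => -[a b]; rewrite !inE unfold_in /= !xpair_eqE.
apply/andP/orP => [[ab /eqP eq_ab]|]; last first.
  by case=> /andP[/eqP-> /eqP->]; rewrite ?[adj y x]adj_sym xy ?eqxx ?[[set y; x]]setUC.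
have neq_ab := adj_neq ab.
have := set21 a b; have := set22 a b; rewrite eq_ab !inE.
by case/orP=> /eqP eb; case/orP => /eqP ea; move: neq_ab;
  rewrite ea eb ?eqxx // => _; [right|left].
Qed.

(** A triangle on an edge is determined by its third vertex: [w |-> w |: [set u; v]] is a bijection
    from the common neighbours of [u] and [v]. *)
Lemma card_triangles_edge (G : sgraph) (u v : G) : adj u v ->
  #|[set t in triangles G | [set u; v] \subset t]|
  = #|[set w | adj u w && adj v w]|.
Proof.
move=> uv; have neq_uv := adj_neq uv.
have notin w : adj u w && adj v w -> w \notin [set u; v].
  by case/andP=> /adj_neq uw /adj_neq vw; rewrite !inE negb_or ![w == _]eq_sym uw.
rewrite -[RHS](@card_in_imset _ _ (fun w => w |: [set u; v])); last first.
  move=> w w'; rewrite !inE => /notin nw /notin nw' eqw.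
  have: w \in w' |: [set u; v] by rewrite -eqw setU11.
  by rewrite in_setU1 (negPf nw) orbF => /eqP.
apply: eq_card => t; apply/idP/imsetP => [|[w]].
  rewrite !inE => /andP[/andP[/eqP t3 /forall_inP clique] uv_t].
  have /cards1P[w eq_w] : #|t :\: [set u; v]| == 1.
    by rewrite cardsD (setIidPr uv_t) t3 cards2 neq_uv.
  have : w \in t :\: [set u; v] by rewrite eq_w set11.
  rewrite !inE negb_or => /andP[/andP[wu wv] wt].
  have adj_w x : x \in [set u; v] -> adj x w.
    move=> x_uv; have /forall_inP/(_ w wt)/implyP := clique x (subsetP uv_t x x_uv).
    by apply; move: x_uv; rewrite !inE => /orP[] /eqP->; rewrite eq_sym.
  exists w; first by rewrite inE !adj_w ?set21 ?set22.
  by rewrite -[LHS](setID t [set u; v]) (setIidPr uv_t) eq_w setUC.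
rewrite inE => adj_w ->; rewrite !inE cardsU1 cards2 (notin _ adj_w) neq_uv subsetUr !andbT /=.
case/andP: adj_w => uw vw.
apply/forall_inP => x; rewrite !inE => x_t; apply/forall_inP => y; rewrite !inE => y_t.
case/or3P: x_t => /eqP->; case/or3P: y_t => /eqP->;
  by rewrite ?eqxx // ?[adj w _]adj_sym ?[adj v u]adj_sym ?uw ?vw ?uv implybT.
Qed.

(** * Distance from a root *)

Section Distance.
Variables (G : sgraph) (r : G).
Hypothesis connG : connected_graph G.

(** Walks of length exactly [n], as a boolean, so that [ex_minn] can pick the shortest length. *)
Definition reach (v : G) (n : nat) : bool :=
  [exists p : n.-tuple G, path (@adj G) r p && (last r p == v)].

Lemma reachP v n :
  reflect (exists p, [/\ size p = n, path (@adj G) r p & last r p = v]) (reach v n).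
Proof.
apply: (iffP existsP) => [[p /andP[rp /eqP lp]]|[p [sp rp lp]]].
  by exists p; rewrite size_tuple.
by exists (tcast sp (in_tuple p)); rewrite val_tcast /= rp lp eqxx.
Qed.

Lemma reach_ex v : exists n, reach v n.
Proof.
by have /connectP[p rp lp] := connG r v; exists (size p); apply/reachP; exists p.
Qed.

Definition dist v := ex_minn (reach_ex v).

Lemma dist_step (p w : G) : adj p w -> dist w <= (dist p).+1.
Proof.
rewrite /dist; case: (ex_minnP (reach_ex w)) => m _ min_m.
case: ex_minnP => n /reachP[s [sn rs ls]] _ pw; apply/min_m/reachP.
by exists (rcons s w); rewrite size_rcons sn rcons_path rs ls pw last_rcons.
Qed.

Lemma dist_parent v : v != r -> exists2 p, adj p v & dist v = (dist p).+1.
Proof.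
move=> neq_vr; suff [p pv le_p] : exists2 p, adj p v & dist p < dist v.
  by exists p => //; apply/eqP; rewrite eqn_leq le_p dist_step.
rewrite {2}/dist; case: ex_minnP => n /reachP[s [sn rs ls]] _.
(* The parent is the penultimate vertex of a shortest walk to [v]; that walk is nonempty because
   [v != r]. *)
case/lastP: s sn rs ls => [_ _ /= rv|s x]; first by rewrite rv eqxx in neq_vr.
rewrite size_rcons rcons_path last_rcons => sn /andP[rs sx] xv; subst x.
exists (last r s) => //; rewrite -sn ltnS /dist; case: ex_minnP => m _; apply.
by apply/reachP; exists s.
Qed.

End Distance.

(** * Weighted degree count and the lower bound *)

Lemma sum_adj_weighted (G : sgraph) (d : G -> nat) :
  \sum_(v : G) \sum_(w : G) adj v w =
  \sum_(v : G) (#|[set w | adj v w & d w <= d v]| + #|[set w | adj v w & d w < d v]|).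
Proof.
have cardE (v : G) (P : pred G) : #|[set w | adj v w & P w]| = \sum_w (adj v w && P w).
  by rewrite -sum1dep_card big_mkcond.
under [RHS]eq_bigr => v _ do rewrite !cardE.
(* Exchanging [v] and [w] in the strict count turns its condition into [d v < d w], the complement
   of [d w <= d v]. *)
rewrite big_split /= [X in _ = _ + X]exchange_big -big_split /=.
apply: eq_bigr => v _; rewrite -big_split /=; apply: eq_bigr => w _.
by rewrite [adj w v]adj_sym ltnNge; case: (adj v w); case: leqP.
Qed.

Lemma truss_edges_lower_bound (G : sgraph) (k : nat) :
  connected_graph G -> truss k G -> #|G|.-1 * k.+2 <= (#|edges G|).*2.
Proof.
move=> connG [_ trussG]; have [->//|] := posnP #|G|; case/card_gt0P => r _.
rewrite -handshake (sum_adj_weighted (dist r connG)) (bigD1 r) //=.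
apply: leq_trans (leq_addl _ _).
have -> : #|G|.-1 = #|predC1 r| by rewrite cardC1.
rewrite -sum_nat_const; apply: leq_sum => v; rewrite inE => neq_vr.
have [p pv dv] := dist_parent connG neq_vr.
(* Split [k + 2] as [(k + 1) + 1]: the parent [p] alone gives the strict count its 1, while [p] and
   the common neighbours of [p] and [v] give the weak count its [k + 1]. *)
rewrite -addn1 leq_add //; last first.
  by apply/card_gt0P; exists p; rewrite inE adj_sym pv dv /=.
have k_le : k <= #|[set w | adj p w && adj v w]|.
  by rewrite -card_triangles_edge //; apply: trussG; apply/edgesP; exists p, v.
have /leq_trans : k.+1 <= #|p |: [set w | adj p w && adj v w]|.
  by rewrite cardsU1 inE adj_irrefl.
apply; apply/subset_leq_card/subsetP => w; rewrite !inE.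
case/predU1P => [->|/andP[pw ->]]; first by rewrite adj_sym pv dv /=.
by rewrite dv dist_step.
Qed.

(** * Windmill graphs for the upper bound *)

Lemma big_option (T : finType) (F : option T -> nat) :
  \sum_x F x = F None + \sum_t F (Some t).
Proof.
have enum_option : enum {: option T} = None :: map Some (enum T).
  by rewrite !enumT [in LHS]unlock.
by rewrite -[LHS]big_enum enum_option big_cons big_map big_enum.
Qed.

Section Windmill.
Variables (k q s : nat).

(* The vertices other than the hub [None]: [q + 1] blocks of size [k + 1], and
   [s] extra vertices joined to the block [ord0]. *)
Let blade : finType := ('I_q.+1 * 'I_k.+1 + 'I_s)%type.

Definition block (t : blade) : 'I_q.+1 :=
  match t with inl bi => bi.1 | inr _ => ord0 end.

Definition windmill_adj (x y : option blade) : bool :=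
  (x != y) && match x, y with Some t, Some u => block t == block u | _, _ => true end.

Lemma windmill_adj_sym : symmetric windmill_adj.
Proof.
move=> x y; rewrite /windmill_adj eq_sym.
by case: x y => [t|] [u|] //; rewrite [block t == _]eq_sym.
Qed.

Lemma windmill_adj_irrefl : irreflexive windmill_adj.
Proof. by move=> x; rewrite /windmill_adj eqxx. Qed.

Definition windmill : sgraph := SGraph windmill_adj_sym windmill_adj_irrefl.

Lemma card_block b : #|[set t | block t == b]| = k.+1 + (b == ord0) * s.
Proof.
rewrite -sum1dep_card big_mkcond big_sumType /=; congr (_ + _).
  rewrite -(pair_bigA _ (fun c (_ : 'I_k.+1) => if c == b then 1 else 0)) /=.
  rewrite (bigD1 b) //= eqxx sum1_card card_ord big1 ?addn0 // => c /negPf->.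
  by rewrite big1.
rewrite eq_sym; case: (b == ord0); last by rewrite big1.
by rewrite sum1_card card_ord mul1n.
Qed.

Lemma card_windmill : #|windmill| = (q.+1 * k.+1 + s).+1.
Proof. by rewrite card_option card_sum card_prod !card_ord. Qed.

Lemma windmill_connected : connected_graph windmill.
Proof.
move=> x y; apply: (@connect_trans _ _ None).
  by case: x => [t|]; [exact: connect1|exact: connect0].
by case: y => [t|]; [exact: connect1|exact: connect0].
Qed.

Lemma windmill_truss : truss k windmill.
Proof.
split=> [[t|]|f /edgesP[x [y [xy ->]]]].
- by exists None.
- by exists (Some (inl (ord0, ord0))).
rewrite card_triangles_edge //.
(* Both endpoints lie in the clique formed by the hub and some block [b]. It has at least [k + 2]
   vertices, so at least [k] remain besides [x] and [y]. *)
have [b sub_b] : exists b, None |: [set Some t | t in [set t | block t == b]] \subset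
    x |: (y |: [set w : windmill | adj x w && adj y w]).
  have [b xb yb] : exists2 b, (if x is Some t then block t == b else true)
                            & (if y is Some t then block t == b else true).
    move: x y xy => [t|] [u|]; rewrite /= /windmill_adj //=.
    - by case/andP=> _ /eqP tu; exists (block u); rewrite ?tu.
    - by exists (block t).
    - by exists (block u).
  exists b; apply/subsetP => z.
  case/setU1P=> [->|/imsetP[t]]; rewrite !inE /= /windmill_adj.
    by case: x y {xy xb yb} => [?|] [?|].
  move=> /eqP tb ->; rewrite ![_ == Some t]eq_sym.
  case: eqVneq => //= _; case: eqVneq => //= _.
  by move: x y xb yb {xy} => [?|] [?|] /= xb yb; rewrite ?(eqP xb) ?(eqP yb) ?tb ?eqxx.
have := subset_leq_card sub_b.
rewrite !cardsU1 card_imset; last exact: Some_inj.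
rewrite card_block; case: imsetP => [[]//|_] /=.
by case: (x \notin _); case: (y \notin _) => /=; nia.
Qed.

Lemma windmill_edges :
  (#|edges windmill|).*2 = #|windmill|.-1 * k.+2 + s * (k.+1 + s).
Proof.
rewrite -handshake card_windmill big_option /= [X in X + _]big_option /=.
have -> : \sum_(t : blade) windmill_adj None (Some t) = q.+1 * k.+1 + s.
  by rewrite sum1_card card_sum card_prod !card_ord.
(* The degree of [Some t] is the size of its block: the hub makes up for [t] itself. *)
have deg t : \sum_(y : windmill) windmill_adj (Some t) y = k.+1 + (block t == ord0) * s.
  rewrite big_option -card_block -sum1dep_card [RHS]big_mkcond /=.
  rewrite (bigD1 t) //= [RHS](bigD1 t) //= eqxx /windmill_adj eqxx add0n; congr (_ + _).
  apply: eq_bigr => u neq_ut; rewrite (inj_eq Some_inj) eq_sym neq_ut /= eq_sym.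
  by case: (_ == _).
under eq_bigr do rewrite deg.
rewrite big_split /= sum_nat_const -big_distrl /=.
have -> : \sum_t (block t == ord0) = k.+1 + s.
  by rewrite -[RHS]/(k.+1 + s) -[s in RHS]mul1n -(card_block ord0) -sum1dep_card [RHS]big_mkcond.
rewrite card_sum card_prod !card_ord; lia.
Qed.

End Windmill.

(** * Existence of the minimum and the final estimates *)

Lemma exists_min_edges (n k : nat) (G : sgraph) : connected_truss n k G ->
  exists m, is_min_edges n k m.
Proof.
(* Being the edge count of some connected truss is made boolean classically, so that [ex_minn]
   applies. *)
move=> trG; pose P m := `[< exists2 G : sgraph, connected_truss n k G & #|edges G| = m >].
have exP : exists m, P m by exists #|edges G|; apply/asboolP; exists G.
exists (ex_minn exP); case: ex_minnP => m /asboolP Pm min_m; split=> // H trH.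
by apply: min_m; apply/asboolP; exists H.
Qed.

Local Open Scope ring_scope.

Theorem theorem2p5 (R : realType) :
  exists C : R, 0 < C /\
    forall k n : nat, (1 <= k)%N -> (k + 2 <= n)%N ->
    exists M : nat,
      [/\ is_min_edges n k M,
          (n%:R - 1) * (1 + k%:R / 2%:R) <= (M%:R : R),
          (M%:R : R) <= n%:R * (1 + k%:R / 2%:R) + C * k%:R ^+ 2
        & (n = 1 %[mod k.+1])%N ->
          (M%:R : R) = (n%:R - 1) * (1 + k%:R / 2%:R)].
Proof.
(* A generous constant: the excess in [2 |E|] is [s (k + 1 + s) <= k (2 k + 1) <= 3 k^2], well below
   [12 k^2]. *)
exists 6%:R; split=> [|k n k_gt0 le_kn]; first exact: ltr0Sn.
case: n le_kn => [|m]; first by rewrite addn2.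
rewrite addn2 ltnS => lt_km.
(* The predecessor compensates for [windmill k q s] having [q + 1] blocks; the quotient is positive
   since [m >= k + 1]. *)
pose q := (m %/ k.+1).-1; pose s := (m %% k.+1)%N.
have q_gt0 : (0 < m %/ k.+1)%N by rewrite divn_gt0.
have def_m : m = (q.+1 * k.+1 + s)%N by rewrite /q prednK // -divn_eq.
have le_sk : (s <= k)%N by rewrite -ltnS ltn_pmod.
have trW : connected_truss m.+1 k (windmill k q s).
  split; [by rewrite card_windmill -def_m|exact: windmill_connected|exact: windmill_truss].
have [M minM] := exists_min_edges trW; exists M.
have [[G [cardG connG trG] cardE] min_G] := minM.
have lower : (m * k.+2 <= M.*2)%N.
  by have := truss_edges_lower_bound connG trG; rewrite cardG cardE.
have upper : (M.*2 <= m * k.+2 + s * (k.+1 + s))%N.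
  have := windmill_edges k q s; rewrite card_windmill -def_m /= => <-.
  by rewrite leq_double; exact: min_G trW.
have upper6 : (M.*2 <= m.+1 * k.+2 + 12 * (k * k))%N.
  by apply: leq_trans upper _; nia.
have m1E : m.+1%:R = m%:R + 1 :> R by rewrite natr1.
have lowerR : m%:R * (k%:R + 2%:R) <= M%:R * 2%:R :> R.
  by rewrite -!(natrD, natrM) ler_nat addn2 muln2.
have upperR : M%:R * 2%:R <= (m%:R + 1) * (k%:R + 2%:R) + 12%:R * (k%:R * k%:R) :> R.
  by rewrite natr1 -!(natrD, natrM) ler_nat addn2 muln2.
rewrite m1E; split=> //; [lra|lra|move=> m1].
have s0 : s = 0%N.
  have : (k.+1 %| m.+1 - 1)%N by rewrite -eqn_mod_dvd //; apply/eqP.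
  by rewrite subn1 => /eqP.
have : M%:R * 2%:R = m%:R * (k%:R + 2%:R) :> R.
  rewrite -!(natrD, natrM); congr _%:R; apply/eqP.
  by rewrite muln2 addn2 eqn_leq lower andbT (leq_trans upper) // s0 mul0n addn0.
lra.
Qed.
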